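(* Let $K\ge2$ with $\frac nK\ge2$, and let $\Theta=\Theta(n,K,a,b)$ be the homogeneous balanced SBM parameter class with $K$ communities, within-community edge probability $a/n$, across-community edge probability $b/n$, and balanced labelings in $\Sigma$; for $\theta\in\Theta$, let $\sigma_\theta\in\Sigma$ be a representative ground-truth labeling and $\mathbb E_\theta$ the expectation under the SBM law corresponding to $\theta$ (and the internal randomness of the mechanism). Let $\gamma_n\geq 0$ be such that $1-n\gamma_n-\delta>0$. Suppose an $(\varepsilon,\delta)$-node-DP mechanism $\mathcal M:\mathcal G_n\to[K]^n$ satisfies $$\sup_{\theta\in\Theta}\mathbb E_\theta r(\sigma_\theta,\mathcal M(A))\le\gamma_n.$$ Then $$\varepsilon\ge\frac12\log\left(\frac{1-n\gamma_n-\delta}{n\gamma_n+\delta}\right).$$ In particular, if $\gamma_n\precsim\frac1{nf(n)}$ and $\delta\precsim n^{-c}$, where $c>0$ and $f(n)\to\infty$, then for all sufficiently large $n$ we have $\varepsilon\succsim\min\{\log(f(n)),\,c\log(n)\}$.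
   Context: $n,K$ are integers with $K\mid n$; $\varepsilon,\delta\ge0$. $\mathcal G_n$ is the set of undirected graphs on $[n]=\{1,\dots,n\}$, identified with symmetric zero-diagonal adjacency matrices $A\in\{0,1\}^{n\times n}$. $\Sigma=\{\sigma:[n]\to[K]:|\sigma^{-1}(k)|=n/K\ \forall k\in[K]\}$. The SBM with ground truth $\sigma\in\Sigma$ draws the upper-triangular entries of $A$ independently with $\mathbb P(A_{ij}=1)=a/n$ if $\sigma(i)=\sigma(j)$ and $b/n$ otherwise; the class $\Theta$ consists of the SBMs obtained as $\sigma$ ranges over $\Sigma$. For $\sigma,\tau\in[K]^n$: $h(\sigma,\tau)=|\{i:\sigma_i\ne\tau_i\}|$ and $r(\sigma,\tau)=\frac1n\min_{\pi\in\mathfrak S_K}h(\pi\circ\sigma,\tau)$, with $\mathfrak S_K$ the permutations of $[K]$. Two graphs are node-adjacent, $A\sim_vA'$, if they differ only on edges incident to a single vertex. A randomized mechanism $\mathcal M$ on $\mathcal G_n$ is $(\varepsilon,\delta)$-node-DP if $\mathbb P(\mathcal M(A)\in S)\le e^\varepsilon\mathbb P(\mathcal M(A')\in S)+\delta$ for all $A\sim_vA'$ and all measurable $S$. $f(n)\precsim g(n)$ means $f(n)\le c_1g(n)$ for $n\ge c_2$, for constants $c_1,c_2\in(0,\infty)$; $f\succsim g$ means $g\precsim f$. In the ''in particular'' part, $\varepsilon,\delta,K,a,b$ may depend on $n$. The bound is read as $+\infty$ if $n\gamma_n+\delta=0$. *)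

(* Defs.v *)
From HB Require Import structures.
From mathcomp Require Import all_boot all_order all_algebra all_fingroup.
From mathcomp Require Import all_classical all_reals all_analysis.
Set Implicit Arguments.
Unset Strict Implicit.
Unset Printing Implicit Defensive.
Import Order.TTheory GRing.Theory Num.Theory.
Import numFieldNormedType.Exports.
Local Open Scope classical_set_scope.
Local Open Scope ring_scope.

Definition is_adjacency (n : nat) (A : 'M[bool]_n) : bool :=
  (A^T == A) && [forall i, ~~ A i i].

Notation graph n := {A : 'M[bool]_n | is_adjacency A}.

Notation labeling n K := {ffun 'I_n -> 'I_K}.

Definition balanced (n K : nat) (s : labeling n K) : Prop :=
  forall k : 'I_K, #|[set i | s i == k]%SET| = (n %/ K)%N.

Definition hamming (n K : nat) (s t : labeling n K) : nat :=
  #|[set i | s i != t i]%SET|.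

(* The default value [n] of the minimum is harmless: [hamming] never exceeds
   [n] and ['S_K] is never empty. *)
Definition misclass (R : realType) (n K : nat) (s t : labeling n K) : R :=
  (\big[minn/n]_(p : 'S_K) hamming [ffun i => p (s i)] t)%:R / n%:R.

Record fdist (R : realType) (T : finType) := FDist {
  pmf :> T -> R;
  pmf_ge0 : forall x, 0 <= pmf x;
  pmf_sum1 : \sum_(x : T) pmf x = 1 }.

Definition Pr (R : realType) (T : finType) (p : T -> R) (S : {set T}) : R :=
  \sum_(x in S) p x.

Definition expect (R : realType) (T : finType) (p X : T -> R) : R :=
  \sum_(x : T) p x * X x.

(* A model is a ground-truth labeling together with its matrix of edge
   probabilities, so that the labeling is part of the parameter even in the
   degenerate case a = b, where the graph law does not determine it. *)
Definition sbm_param (R : realType) (n K : nat) : Type :=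
  (labeling n K * 'M[R]_n)%type.

Definition Theta (R : realType) (n K : nat) (a b : R) :
    set (sbm_param R n K) :=
  [set (s, \matrix_(i, j) (if s i == s j then a / n%:R else b / n%:R))
     | s in [set s | balanced s]].
Arguments Theta {R} n K a b.

(* Probability mass function of the random graph whose upper-triangular
   entries are independent, the (i, j) entry being 1 with probability
   [theta.2 i j]; it is a probability when these entries lie in [0, 1]. *)
Definition sbm_law (R : realType) (n K : nat) (theta : sbm_param R n K)
    (A : graph n) : R :=
  \prod_(i < n) \prod_(j < n | (i < j)%N)
    (if val A i j then theta.2 i j else 1 - theta.2 i j).

Definition mechanism (R : realType) (n K : nat) : Type :=
  graph n -> fdist R (labeling n K).

Definition node_adjacent (n : nat) (A A' : graph n) : Prop :=
  exists v : 'I_n, forall i j : 'I_n,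
    i != v -> j != v -> val A i j = val A' i j.

Definition node_dp (R : realType) (n K : nat) (eps delta : R)
    (M : mechanism R n K) : Prop :=
  forall A A' : graph n, node_adjacent A A' ->
  forall S : {set labeling n K},
    Pr (M A) S <= expR eps * Pr (M A') S + delta.

Definition risk (R : realType) (n K : nat) (M : mechanism R n K)
    (theta : sbm_param R n K) : R :=
  expect (sbm_law theta)
    (fun A => expect (M A) (fun t => misclass R theta.1 t)).

Definition worst_risk (R : realType) (n K : nat) (a b : R)
    (M : mechanism R n K) : \bar R :=
  ereal_sup [set (risk M theta)%:E | theta in Theta n K a b].

(* The standing assumptions on (n, K, a, b, eps, delta, gamma); the bounds on
   a and b say that a / n and b / n are probabilities. *)
Definition admissible (R : realType) (n K : nat) (a b eps delta gamma : R) :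
    Prop :=
  [/\ (2 <= K)%N, (K %| n)%N & (2 <= n %/ K)%N] /\
  [/\ 0 <= a <= n%:R & 0 <= b <= n%:R] /\
  [/\ 0 <= eps, 0 <= delta, 0 <= gamma & 0 < 1 - n%:R * gamma - delta].

(* f ≾ g as n tends to infinity within the index set D.  An index set is
   needed because K | n with 2 <= K and 2 <= n / K excludes, e.g., the primes. *)
Definition precsim (R : realType) (D : set nat) (f g : nat -> R) : Prop :=
  exists c1 c2 : R, [/\ 0 < c1, 0 < c2 &
    forall n, D n -> c2 <= n%:R -> f n <= c1 * g n].

(* The quotient is 0, and so is its [ln], when n * gamma + delta = 0: the value
   +oo that the bound then has must be given separately. *)
Definition privacy_bound (R : realType) (n : nat) (delta gamma : R) : \bar R :=
  let q := n%:R * gamma + delta in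
  if q == 0 then +oo%E
  else (2^-1 * ln ((1 - n%:R * gamma - delta) / q))%:E.

(* Main.v *)
Require Import Defs.
From HB Require Import structures.
From mathcomp Require Import all_boot all_order all_algebra all_fingroup.
From mathcomp Require Import all_classical all_reals all_analysis.
From mathcomp Require Import ring lra.
Import Order.TTheory GRing.Theory Num.Theory.
Import numFieldNormedType.Exports.
Local Open Scope classical_set_scope.
Local Open Scope ring_scope.

(** If sigma and sigma' differ by swapping the labels of two vertices u and v of
    different communities, then relabelling a graph A by the transposition (u v)
    maps the law of sigma to that of sigma' and changes only edges incident to u
    or v. Hence A and its relabelling are two node-adjacency steps apart, and
    privacy compares the outputs under the two laws up to a factor e^(2 eps).
    As communities have at least two vertices, sigma and sigma' induce different
    partitions, so the events of exact recovery are disjoint; each has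
    probability at least 1 - n gamma under its own law, because a non-zero loss
    is at least 1/n. This yields
    1 - n gamma <= e^(2 eps) n gamma + (1 + e^eps) delta. *)

Set Implicit Arguments.
Unset Strict Implicit.
Unset Printing Implicit Defensive.

(** * Graphs: relabelling, node-adjacency, products over vertex pairs *)

Section Graphs.
Variable n : nat.
Implicit Types (A B : graph n) (s : 'S_n) (u v : 'I_n).

Lemma is_adjacencyP (A : 'M[bool]_n) :
  reflect ((forall i j, A i j = A j i) /\ (forall i, A i i = false))
          (is_adjacency A).
Proof.
apply: (iffP andP) => [[/eqP sA /forallP dA]|[sA dA]]; split.
- by move=> i j; rewrite -{1}sA mxE.
- by move=> i; apply/negbTE/dA.
- by apply/eqP/matrixP => i j; rewrite mxE sA.
- by apply/forallP => i; rewrite dA.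
Qed.

Lemma graph_sym A i j : val A i j = val A j i.
Proof. by case/is_adjacencyP: (valP A). Qed.

Lemma graph_irr A i : val A i i = false.
Proof. by case/is_adjacencyP: (valP A). Qed.

Lemma relabel_subproof s A :
  is_adjacency (\matrix_(i, j) val A (s i) (s j)).
Proof.
apply/is_adjacencyP; split=> [i j|i]; rewrite !mxE ?graph_irr //.
exact: graph_sym.
Qed.

Definition relabel s A : graph n :=
  exist (fun A : 'M[bool]_n => is_adjacency A) _ (relabel_subproof s A).

Lemma relabelK s : cancel (relabel s) (relabel s^-1%g).
Proof. by move=> A; apply/val_inj/matrixP => i j; rewrite !mxE !permKV. Qed.

Lemma relabel_bij s : bijective (relabel s).
Proof.
exists (relabel s^-1%g); first exact: relabelK.
by move=> A; rewrite -{1}(invgK s) relabelK.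
Qed.

Lemma graft_subproof u A B :
  is_adjacency (\matrix_(i, j) if (i == u) || (j == u) then val B i j
                               else val A i j).
Proof.
apply/is_adjacencyP; split=> [i j|i]; rewrite !mxE ?graph_irr ?if_same //.
by rewrite orbC (graph_sym A) (graph_sym B).
Qed.

(** Hybrid that serves as the midpoint of the two privacy steps when [B] is [A] relabelled by the
    transposition of [u] and [v]: one step changes edges at [u], the other edges at [v]. *)
Definition graft u A B : graph n :=
  exist (fun A : 'M[bool]_n => is_adjacency A) _ (graft_subproof u A B).

Lemma node_adjacent_graft u A B : node_adjacent A (graft u A B).
Proof.
by exists u => i j /negPf iu /negPf ju; rewrite mxE iu ju.
Qed.

Lemma node_adjacent_graft_tperm u v A :
  node_adjacent (graft u A (relabel (tperm u v) A)) (relabel (tperm u v) A).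
Proof.
exists v => i j iv jv; rewrite mxE; case: ifPn => //.
by rewrite negb_or => /andP[iu ju]; rewrite mxE !tpermD // eq_sym.
Qed.

(** A permutation acts bijectively on unordered pairs. These are stored in increasing order, so
    [h r] applies [r] and sorts again; symmetry of [g] makes the sorting harmless. *)
Lemma prod_lt_perm (R : comPzRingType) (g : 'I_n -> 'I_n -> R) s :
  (forall i j, g i j = g j i) ->
  \prod_(i < n) \prod_(j < n | (i < j)%N) g (s i) (s j) =
  \prod_(i < n) \prod_(j < n | (i < j)%N) g i j.
Proof.
move=> gC.
pose h (r : 'S_n) (p : 'I_n * 'I_n) :=
  if (r p.1 < r p.2)%N then (r p.1, r p.2) else (r p.2, r p.1).
rewrite !pair_big_dep /=.
have lth r (p : 'I_n * 'I_n) : p.1 != p.2 -> ((h r p).1 < (h r p).2)%N.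
  move=> p12; rewrite /h; case: ifP => //= /negbT.
  rewrite -leqNgt leq_eqVlt => /orP[/eqP/val_inj/perm_inj/esym/eqP|//].
  by rewrite (negPf p12).
have hK r (p : 'I_n * 'I_n) : (p.1 < p.2)%N -> h r^-1%g (h r p) = p.
  case: p => i j /= ij; rewrite /h /=.
  by case: (ltnP (r i)) => _ /=; rewrite !permK ?ij // ltnNge (ltnW ij).
have lt_neq (p : 'I_n * 'I_n) : (p.1 < p.2)%N -> p.1 != p.2.
  by move=> p12; apply: contraTneq p12 => ->; rewrite ltnn.
rewrite [RHS](reindex_onto (h s) (h s^-1%g)) /=; last first.
  by move=> p p12; rewrite -{1}(invgK s) hK.
apply: eq_big => p.
  apply/idP/andP => [p12|[hp /eqP <-]]; first by rewrite hK // lth // lt_neq.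
  by rewrite lth // lt_neq.
by move=> _; rewrite /h; case: ifP => _ //=; rewrite gC.
Qed.

Lemma of_upper_subproof (f : {ffun 'I_n * 'I_n -> bool}) :
  is_adjacency
    (\matrix_(i, j) if (i < j)%N then f (i, j) else (j < i)%N && f (j, i)).
Proof.
apply/is_adjacencyP; split=> [i j|i]; rewrite !mxE ?ltnn //.
by case: ltngtP.
Qed.

(** Distributivity: a graph is a free choice of one bit for each pair [i < j]. This gives the SBM
    law total mass 1. *)
Lemma sum_prod_graph (R : comPzSemiRingType) (g : 'I_n -> 'I_n -> bool -> R) :
  \sum_(A : graph n) \prod_(i < n) \prod_(j < n | (i < j)%N) g i j (val A i j) =
  \prod_(i < n) \prod_(j < n | (i < j)%N) (g i j true + g i j false).
Proof.
rewrite pair_big_dep /=.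
pose up (A : graph n) :=
  [ffun p : 'I_n * 'I_n => (p.1 < p.2)%N && val A p.1 p.2].
pose dn f : graph n :=
  exist (fun A : 'M[bool]_n => is_adjacency A) _ (of_upper_subproof f).
transitivity (\prod_(p : 'I_n * 'I_n | (p.1 < p.2)%N)
                \sum_(b in predT) g p.1 p.2 b); last first.
  by apply: eq_bigr => p _; rewrite big_bool.
(* The expansion ranges over bit functions that are [false] off the pairs [i < j]; [up] and [dn]
   match them with graphs. *)
rewrite (big_distr_big false) /= (reindex_onto up dn) /=; last first.
  move=> f /pfamilyP[/fintype.subsetP fs _]; apply/ffunP => -[i j].
  rewrite ffunE mxE /=; case: ltnP => //= ji.
  apply/esym/negbTE/negP => fij.
  have /fs : (i, j) \in false.-support f by rewrite supportE fij.
  by rewrite unfold_in /= ltnNge ji.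
apply: eq_big => [A|A _].
  apply/esym/andP; split.
    apply/pfamilyP; split=> //; apply/fintype.subsetP => p.
    by rewrite !inE ffunE; case: ltnP.
  apply/eqP/val_inj/matrixP => i j; rewrite mxE !ffunE /=.
  case: ltngtP => [//|_|/val_inj ->]; first by rewrite graph_sym.
  by rewrite graph_irr.
rewrite pair_big_dep /=; apply: eq_bigr => p p12.
by rewrite ffunE p12.
Qed.

End Graphs.

(** * Balanced labelings, exact recovery and the loss *)

Section Labelings.
Variables n K : nat.
Implicit Types s t : labeling n K.

(** Identify the vertices with ['I_K * 'I_(n %/ K)] and label by the first coordinate. *)
Lemma exists_balanced : (0 < K)%N -> (K %| n)%N ->
  exists s : labeling n K, balanced s.
Proof.
move=> K0 Kn.
have eqn : n = #|{: 'I_K * 'I_(n %/ K)}|.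
  by rewrite card_prod !card_ord mulnC divnK.
pose g (i : 'I_n) := enum_val (cast_ord eqn i).
have gbij : bijective g.
  exists (fun p => cast_ord (esym eqn) (enum_rank p)) => x.
    by rewrite /g enum_valK cast_ordK.
  by rewrite /g cast_ordKV enum_rankK.
exists [ffun i => (g i).1] => k.
have -> : [set i | [ffun i => (g i).1] i == k]%SET =
          (g @^-1: finset.setX [set k] [set: 'I_(n %/ K)])%SET.
  by apply/setP => i; rewrite !inE ffunE andbT.
rewrite on_card_preimset; last exact: onW_bij.
by rewrite cardsX cards1 mul1n cardsT card_ord.
Qed.

(** The event of exact recovery, that is, of zero loss against [s]. *)
Definition same_partition s : {set labeling n K} :=
  [set t | [exists p : 'S_K, t == [ffun i => p (s i)]]]%SET.

Lemma same_partitionP s t i j : t \in same_partition s ->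
  (t i == t j) = (s i == s j).
Proof.
rewrite inE => /existsP[p /eqP ->]; rewrite !ffunE.
by apply/eqP/eqP => [/perm_inj|->].
Qed.

Definition swap_labels u v s : labeling n K := [ffun i => s (tperm u v i)].

Lemma balanced_swap u v s : balanced s -> balanced (swap_labels u v s).
Proof.
move=> bs k; rewrite -(bs k) -(card_imset _ (@perm_inj _ (tperm u v))).
apply: eq_card => i; rewrite !inE.
apply/imsetP/idP => [[j]|si]; first by rewrite inE ffunE => /eqP <- ->.
by exists (tperm u v i); rewrite ?inE ?ffunE tpermK.
Qed.

(** Besides [u], its community contains some [w]. Exchanging [u] with a vertex [v] of another
    community separates [u] from [w], so no labeling can agree with both partitions. *)
Lemma exists_swap s : (2 <= K)%N -> (2 <= n %/ K)%N -> balanced s ->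
  exists u v, [disjoint same_partition s & same_partition (swap_labels u v s)]%B.
Proof.
move=> K2 nK2 bs.
have [/card_gt1P[u [w [+ + uw]]] /card_gt0P[v]] :
    (1 < #|[set i | s i == Ordinal (ltnW K2)]%SET|)%N /\
    (0 < #|[set i | s i == Ordinal K2]%SET|)%N.
  by rewrite !bs (ltnW nK2).
rewrite !inE => /eqP su /eqP sw /eqP sv; exists u, v.
rewrite finset.disjoints_subset; apply/fintype.subsetP => t ts; rewrite inE; apply/negP => ts'.
have := same_partitionP u w ts'; rewrite (same_partitionP u w ts).
rewrite !ffunE tpermL tpermD //; last first.
  by apply/eqP => vw; move: sv; rewrite vw sw => /(congr1 val).
by rewrite su sw sv eqxx => /esym/eqP/(congr1 val).
Qed.

Lemma misclass_ge (R : realType) s t : (0 < n)%N ->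
  n%:R^-1 *+ (t \notin same_partition s) <= misclass R s t.
Proof.
move=> n0; rewrite /misclass; case: (boolP (t \in _)) => [|tNs] /=.
  by move=> _; rewrite divr_ge0.
rewrite -[leLHS]mul1r ler_wpM2r // ler1n.
(* Positivity passes to minima, and the default value [n] is positive by [n0]; only the individual
   distances remain. *)
elim/big_ind: _ => // [x y x0 y0|p _]; first by rewrite leq_min x0.
rewrite /hamming card_gt0; apply: contra tNs => /eqP h0.
rewrite inE; apply/existsP; exists p; apply/eqP/ffunP => i.
have /setP/(_ i) := h0; rewrite !inE => /negbFE/eqP <-.
by rewrite ffunE.
Qed.

End Labelings.

(** * Finite expectations *)

Section Probability.
Variable R : realType.

Lemma expect_pmf_indic (T : finType) (p : fdist R T) (S : {set T}) :
  expect p (fun x => 1 *+ (x \notin S)) = 1 - Pr p S.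
Proof.
rewrite /expect /Pr -[X in _ = X - _](pmf_sum1 p) (bigID (mem S)) /=.
rewrite [X in _ = X - _](bigID (mem S)) /= [X in X + _ = _]big1 ?add0r.
  rewrite [RHS]addrC addKr.
  by apply: eq_bigr => x ->; rewrite mulr1.
by move=> x ->; rewrite mulr0.
Qed.

Lemma le_expect (T : finType) (p X Y : T -> R) :
  (forall x, 0 <= p x) -> (forall x, X x <= Y x) -> expect p X <= expect p Y.
Proof. by move=> p0 XY; apply: ler_sum => x _; apply: ler_wpM2l. Qed.

Lemma expect_affine (T : finType) (p X : T -> R) (c d : R) :
  \sum_x p x = 1 -> expect p (fun x => c * X x + d) = c * expect p X + d.
Proof.
move=> p1; rewrite /expect mulr_sumr -[in RHS](mulr1 d) -p1 mulr_sumr.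
by rewrite -big_split; apply: eq_bigr => x _ /=; rewrite mulrDr mulrCA (mulrC d).
Qed.

Lemma Pr_disjoint (T : finType) (p : fdist R T) (S S' : {set T}) :
  [disjoint S & S']%B -> Pr p S + Pr p S' <= 1.
Proof.
move=> dS; rewrite /Pr -bigU // -(pmf_sum1 p).
rewrite [leRHS](bigID [in [predU S & S']]) /= lerDl.
by apply: sumr_ge0 => x _; apply: Defs.pmf_ge0.
Qed.

End Probability.

(** * Exact recovery against privacy under two swapped models *)

Section Privacy.
Variables (R : realType) (n K : nat) (a b : R).
Hypotheses (n_gt0 : (0 < n)%N) (a_bd : 0 <= a <= n%:R) (b_bd : 0 <= b <= n%:R).
Implicit Types (s : labeling n K) (M : mechanism R n K).

Definition sbm s : sbm_param R n K :=
  (s, \matrix_(i, j) (if s i == s j then a / n%:R else b / n%:R)).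

Lemma sbm_law_ge0 s A : 0 <= sbm_law (sbm s) A.
Proof.
have pr (c : R) : 0 <= c <= n%:R -> 0 <= c / n%:R /\ 0 <= 1 - c / n%:R.
  case/andP=> c0 cn; split; first exact: divr_ge0.
  by rewrite subr_ge0 ler_pdivrMr ?ltr0n // mul1r.
have [a0 a1] := pr _ a_bd; have [b0 b1] := pr _ b_bd.
apply: prodr_ge0 => i _; apply: prodr_ge0 => j _; rewrite mxE.
by case: ifP; case: ifP.
Qed.

Lemma sbm_law_sum1 (theta : sbm_param R n K) :
  \sum_(A : graph n) sbm_law theta A = 1.
Proof.
rewrite (sum_prod_graph
  (fun i j e => if e then theta.2 i j else 1 - theta.2 i j)).
by rewrite big1 // => i _; rewrite big1 // => j _; rewrite addrC subrK.
Qed.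

(** Each factor on the left is the factor of [sbm s] at the transposed pair, so only the order of
    the product changes. *)
Lemma sbm_law_swap u v s A :
  sbm_law (sbm (swap_labels u v s)) (relabel (tperm u v) A) =
  sbm_law (sbm s) A.
Proof.
pose g i j :=
  if val A i j then (sbm s).2 i j else 1 - (sbm s).2 i j.
rewrite [RHS](_ : _ = \prod_(i < n) \prod_(j < n | (i < j)%N) g i j) //.
rewrite -(prod_lt_perm (tperm u v)); last first.
  by move=> i j; rewrite /g graph_sym !mxE eq_sym.
by do 2!apply: eq_bigr => ? _; rewrite /g !mxE !ffunE.
Qed.

(** Markov's inequality for the loss at level 1/n. *)
Lemma recovery_ge M s (gamma : R) : balanced s ->
  (worst_risk a b M <= gamma%:E)%E ->
  1 - n%:R * gamma <=
  expect (sbm_law (sbm s)) (fun A => Pr (M A) (same_partition s)).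
Proof.
move=> bs Mg; have n0 : 0 < n%:R :> R by rewrite ltr0n.
have : risk M (sbm s) <= gamma.
  rewrite -lee_fin; apply: le_trans Mg; apply: ereal_sup_ubound.
  by exists (sbm s) => //; exists s.
have : expect (sbm_law (sbm s)) (fun A =>
    (- n%:R^-1) * Pr (M A) (same_partition s) + n%:R^-1) <= risk M (sbm s).
  apply: le_expect => [A|A]; first exact: sbm_law_ge0.
  rewrite (_ : _ + _ = n%:R^-1 * (1 - Pr (M A) (same_partition s))); last by ring.
  rewrite -expect_pmf_indic /expect mulr_sumr; apply: ler_sum => t _.
  rewrite mulrCA ler_wpM2l ?Defs.pmf_ge0 // mulr_natr.
  exact: misclass_ge.
rewrite expect_affine ?sbm_law_sum1 // => /le_trans/[apply].
rewrite -(ler_pM2l n0) mulrDr mulrA mulrN divff ?gt_eqF //; lra.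
Qed.

(** Privacy is chained through the graft; the [delta] of the second step is multiplied by the factor
    [expR eps] of the first. *)
Lemma node_dp_swap M (eps delta : R) u v A (S : {set labeling n K}) :
  node_dp eps delta M ->
  Pr (M A) S <= expR eps ^+ 2 * Pr (M (relabel (tperm u v) A)) S +
                (1 + expR eps) * delta.
Proof.
move=> dp; have e0 := expR_ge0 eps.
have := dp _ _ (node_adjacent_graft u A (relabel (tperm u v) A)) S.
have /(ler_wpM2l e0) := dp _ _ (node_adjacent_graft_tperm u v A) S.
rewrite expr2; lra.
Qed.

Lemma node_dp_tradeoff M (eps delta gamma : R) :
  (2 <= K)%N -> (K %| n)%N -> (2 <= n %/ K)%N ->
  node_dp eps delta M -> (worst_risk a b M <= gamma%:E)%E ->
  1 - n%:R * gamma <=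
  expR eps ^+ 2 * (n%:R * gamma) + (1 + expR eps) * delta.
Proof.
move=> K2 Kn nK2 dp Mg.
have [s bs] := exists_balanced (ltnW K2) Kn.
have [u [v dis]] := exists_swap K2 nK2 bs.
set s' := swap_labels u v s in dis.
have bs' : balanced s' by exact: balanced_swap.
apply: le_trans (recovery_ge bs Mg) _.
apply: le_trans (le_expect (sbm_law_ge0 s)
  (fun A => node_dp_swap u v A (same_partition s) dp)) _.
rewrite (expect_affine (fun A => Pr (M (relabel (tperm u v) A)) _));
  last exact: sbm_law_sum1.
rewrite lerD2r ler_wpM2l ?exprn_ge0 ?expR_ge0 //.
(* Change of variables: relabelling carries the law of [s] to that of [s']. *)
have -> : expect (sbm_law (sbm s))
    (fun A => Pr (M (relabel (tperm u v) A)) (same_partition s)) =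
  expect (sbm_law (sbm s')) (fun A => Pr (M A) (same_partition s)).
  rewrite /expect [RHS](reindex (relabel (tperm u v))) /=; last first.
    exact/onW_bij/relabel_bij.
  by apply: eq_bigr => A _; rewrite sbm_law_swap.
have := recovery_ge bs' Mg.
(* By disjointness, recovering [s] under the law of [s'] has probability at most that of missing
   [s'], hence at most [n%:R * gamma]. *)
suff : expect (sbm_law (sbm s')) (fun A => Pr (M A) (same_partition s)) <=
  expect (sbm_law (sbm s')) (fun A => - 1 * Pr (M A) (same_partition s') + 1).
  rewrite expect_affine ?sbm_law_sum1 //; lra.
apply: le_expect => A; first exact: sbm_law_ge0.
by have := Pr_disjoint (M A) dis; lra.
Qed.

End Privacy.

(** * The logarithmic bound and its asymptotic form *)

Lemma privacy_lower_bound (R : realType) (n K : nat)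
    (a b eps delta gamma : R) (M : mechanism R n K) :
  admissible n K a b eps delta gamma -> node_dp eps delta M ->
  (worst_risk a b M <= gamma%:E)%E ->
  (privacy_bound n delta gamma <= eps%:E)%E.
Proof.
move=> [[K2 Kn nK2] [[a_bd b_bd] [eps0 delta0 gamma0 gap]]] dp Mg.
have n0 : (0 < n)%N.
  by rewrite lt0n; apply: contraTneq nK2 => ->; rewrite div0n.
have := node_dp_tradeoff n0 a_bd b_bd K2 Kn nK2 dp Mg.
have e1 : 1 <= expR eps by rewrite -expR0 ler_expR.
set q := n%:R * gamma + delta.
have ng0 : 0 <= n%:R * gamma by rewrite mulr_ge0.
move=> tradeoff.
have {tradeoff} main : 1 - n%:R * gamma - delta <= expR eps ^+ 2 * q.
  apply: le_trans (_ : expR eps ^+ 2 * (n%:R * gamma) + expR eps * delta <= _).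
    lra.
  by rewrite mulrDr lerD2l ler_wpM2r // ler_eXnr.
(* If [q = 0], then [main] contradicts [gap], so the infinite value never arises here. *)
rewrite /privacy_bound -/q; case: eqP => [q0|/eqP q0].
  by move: gap; rewrite ltNge (le_trans main) // q0 mulr0.
have q_gt0 : 0 < q by rewrite lt0r q0 addr_ge0.
rewrite lee_fin ler_pdivrMl // -ler_expR lnK ?posrE ?divr_gt0 //.
by rewrite ler_pdivrMr // mulr2n mulrDl mul1r expRD -expr2.
Qed.

(** With m the minimum, q <= 2C e^(-m) <= 1/2, so (1 - q)/q >= 1/(2q) >= e^m/(4C) and 2 eps >= m -
    ln(4C). The threshold on m makes ln(4C) at most m/2, whence the factor 4. *)
Lemma privacy_rate (R : realType) (n : nat) (c C eps delta gamma f : R) :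
  (0 < n)%N -> 0 < f -> 1 <= C -> 0 <= n%:R * gamma + delta ->
  gamma <= C * (1 / (n%:R * f)) -> delta <= C * n%:R `^ (- c) ->
  2 * ln (4 * C) <= Num.min (ln f) (c * ln n%:R) ->
  (privacy_bound n delta gamma <= eps%:E)%E ->
  Num.min (ln f) (c * ln n%:R) <= 4 * eps.
Proof.
move=> n0 f0 C1 q_ge0 gammaC deltaC; set m := Num.min _ _ => mC.
have nR0 : 0 < n%:R :> R by rewrite ltr0n.
set q := n%:R * gamma + delta in q_ge0.
have qm : q <= 2 * C * expR (- m).
  have fm : f^-1 <= expR (- m).
    by rewrite expRN lef_pV2 ?posrE ?expR_gt0 // -ler_ln ?posrE ?expR_gt0 //
      expRK ge_min lexx.
  have nm : n%:R `^ (- c) <= expR (- m).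
    by rewrite /powR gt_eqF // ler_expR mulNr lerN2 ge_min lexx orbT.
  have g1 : n%:R * gamma <= C * f^-1.
    rewrite (le_trans (ler_wpM2l (ltW nR0) gammaC)) //.
    by rewrite div1r invfM mulrCA mulrA -mulrA mulVKf ?gt_eqF.
  have := ler_wpM2l (le_trans ler01 C1) fm.
  have := ler_wpM2l (le_trans ler01 C1) nm.
  rewrite /q; lra.
have C0 : 0 < 4 * C by lra.
have lnC0 : 0 <= ln (4 * C) by apply: ln_ge0; lra.
have mC' : 4 * C <= expR m.
  by rewrite -ler_ln ?posrE ?expR_gt0 // expRK; lra.
have q2 : 2 * q <= 1.
  suff : 4 * C * expR (- m) <= 1 by lra.
  by rewrite expRN ler_pdivrMr ?expR_gt0 // mul1r.
rewrite /privacy_bound -/q; case: eqP => [//|/eqP qn0].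
have q_gt0 : 0 < q by rewrite lt0r qn0.
rewrite lee_fin ler_pdivrMl // => bnd.
have : m - ln (4 * C) <= 2 * eps.
  apply: le_trans bnd.
  have half : 1 <= 2 * (1 - n%:R * gamma - delta) by rewrite /q in q2; lra.
  rewrite -ler_expR lnK; last by rewrite posrE divr_gt0 //; lra.
  rewrite expRD ler_pdivlMr // -(ler_pM2r C0).
  rewrite expRN lnK ?posrE //.
  have -> : expR m * (4 * C)^-1 * q * (4 * C) = expR m * q.
    by field; lra.
  have := ler_wpM2l (expR_ge0 m) qm.
  rewrite mulrCA expRN divff ?gt_eqF ?expR_gt0 // mulr1.
  have := ler_wpM2l (le_trans ler01 C1) half; lra.
lra.
Qed.

Theorem corollary3 (R : realType) :
  (forall (n K : nat) (a b eps delta gamma : R) (M : mechanism R n K),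
     admissible n K a b eps delta gamma ->
     node_dp eps delta M ->
     (worst_risk a b M <= gamma%:E)%E ->
     (privacy_bound n delta gamma <= eps%:E)%E)
  /\
  (forall (D : set nat) (K : nat -> nat) (a b eps delta gamma f : nat -> R)
          (c : R),
     (forall n, D n ->
        admissible n (K n) (a n) (b n) (eps n) (delta n) (gamma n) /\
        exists M : mechanism R n (K n),
          node_dp (eps n) (delta n) M /\
          (worst_risk (a n) (b n) M <= (gamma n)%:E)%E) ->
     0 < c ->
     f n @[n --> within D \oo] --> +oo ->
     precsim D gamma (fun n => 1 / (n%:R * f n)) ->
     precsim D delta (fun n => n%:R `^ (- c)) ->
     precsim D (fun n => Num.min (ln (f n)) (c * ln n%:R)) eps).
Proof.
split=> [n K a b eps delta gamma M|]; first exact: privacy_lower_bound.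
move=> D K a b eps delta gamma f c HD c0 f_oo.
move=> [Cg [Ng [Cg0 Ng0 gammaC]]] [Cd [Nd [Cd0 Nd0 deltaC]]].
(* [C] dominates both constants and 1; [L] is the level the minimum must reach in [privacy_rate]. *)
pose C := 1 + Cg + Cd; pose L := 2 * ln (4 * C).
have /cvgryPge/(_ (expR L)) [Nf _ fL] := f_oo.
(* The sum exceeds each threshold: [Nf] ensures [ln (f n) >= L], and [expR (L / c)] ensures
   [c * ln n%:R >= L]. *)
exists 4, (Ng + Nd + Nf%:R + expR (L / c)); split=> //.
  by rewrite addr_gt0 ?expR_gt0 // ltr_wpDr // addr_gt0.
move=> n Dn nbig.
have Nf0 : 0 <= Nf%:R :> R by [].
have eL0 := expR_gt0 (L / c).
have n0 : (0 < n)%N by rewrite -(ltr0n R); lra.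
have {}fL : expR L <= f n by apply: fL => //=; rewrite -(ler_nat R); lra.
have f0 : 0 < f n by apply: lt_le_trans fL; exact: expR_gt0.
have [adm [M [dp Mg]]] := HD n Dn.
have [_ [_ [_ delta0 gamma0 _]]] := adm.
apply: (@privacy_rate _ _ _ C _ (delta n) (gamma n)) => //.
- by rewrite /C; lra.
- by rewrite addr_ge0 // mulr_ge0.
- apply: le_trans (gammaC n Dn _) _; first lra.
  by rewrite ler_wpM2r ?divr_ge0 ?mulr_ge0 ?(ltW f0) // /C; lra.
- apply: le_trans (deltaC n Dn _) _; first lra.
  by rewrite ler_wpM2r ?powR_ge0 // /C; lra.
- rewrite le_min -[X in X <= ln _ ](expRK L) ler_ln ?posrE ?expR_gt0 // fL /=.
  rewrite -ler_pdivrMl // mulrC -[leLHS]expRK ler_ln ?posrE ?expR_gt0 ?ltr0n //.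
  lra.
- exact: privacy_lower_bound adm dp Mg.
Qed.
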